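(* (i) If $D$ is a connected digraph with $\alpha(D)\le 2$, then $D$ contains a Hamilton orpath with at most two backward arcs. (ii) There is a connected digraph $D$ with $\alpha(D)\le 2$ which has no Hamilton orpath with less than two backward arcs.
   Context: Digraphs are finite, without loops or parallel arcs; two opposite arcs $xy$, $yx$ may both be present. $D$ has vertex set $V(D)$ and arc set $A(D)$. $D$ is connected if its underlying undirected multigraph $UG(D)$ (replace each arc $xy$ by an edge between $x$ and $y$) is connected. The independence number $\alpha(D)$ is the maximum integer $k$ such that $D$ has $k$ vertices with no arc between any two of them. An orpath (oriented path) in $D$ is a sequence $P=x_1x_2\dots x_p$ of distinct vertices such that for every $i\in\{1,\dots,p-1\}$ at least one of $x_ix_{i+1}$, $x_{i+1}x_i$ is in $A(D)$. If $x_ix_{i+1}\in A(D)$, then $x_ix_{i+1}$ is a forward arc of $P$; otherwise $x_{i+1}x_i$ is a backward arc of $P$. Thus the number of backward arcs of $P$ is the number of $i\in\{1,\dots,p-1\}$ with $x_ix_{i+1}\notin A(D)$. An orpath is Hamilton if it contains all vertices of $D$. *)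

(* Defs.v *)
From mathcomp Require Import all_boot.

Set Implicit Arguments.
Unset Strict Implicit.
Unset Printing Implicit Defensive.

(* Parallel arcs are excluded because arcs form a relation; opposite arcs may
   both be present. *)
Record digraph := Digraph {
  vertex :> finType;
  arc : rel vertex;
  arc_irrefl : irreflexive arc }.

Section DigraphNotions.
Variable D : digraph.
Implicit Types (x y : D) (S : {set D}) (p : seq D).

(* Adjacency in UG(D).  Edge multiplicities are dropped: they affect neither
   connectedness nor orpaths. *)
Definition adj : rel D := fun x y => arc x y || arc y x.

(* The digraph without vertices does not count as connected. *)
Definition connected : Prop := 0 < #|D| /\ forall x y, connect adj x y.

Definition independent S : bool :=
  [forall x in S, forall y in S, ~~ arc x y].

Definition alpha : nat := \max_(S : {set D} | independent S) #|S|.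

Definition orpath p : bool := uniq p && sorted adj p.

Definition Hamilton_orpath p : bool := orpath p && [forall x, x \in p].

(* zip p (behead p) lists the pairs (x_i, x_(i+1)) of consecutive vertices. *)
Definition backward_arcs p : nat :=
  count (fun e => ~~ arc e.1 e.2) (zip p (behead p)).

End DigraphNotions.

(* Main.v *)
(* By the Gallai-Milgram theorem D is covered by at most two dipaths P and Q.
   If the end of one is adjacent to the start of the other, concatenate them.
   Otherwise, if each of P and Q is a single vertex or has adjacent ends, both
   can be rotated, at the price of one backward arc each, so that they meet at
   an arc joining them, which connectedness provides.  Otherwise, say, the ends
   of P are not adjacent; since alpha D <= 2 every vertex of Q is adjacent to
   one of them, so the start of Q is adjacent to the start of P, and following
   Q up to where adjacency to the start of P is lost yields a place at which P
   can be inserted into Q. *)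
Require Import Defs.
From mathcomp Require Import all_boot.
(* path.arc shadows arc. *)
Import Defs.

Set Implicit Arguments.
Unset Strict Implicit.
Unset Printing Implicit Defensive.

Section PathCovers.
Variable D : digraph.
Implicit Types (x y z : D) (s t p q : seq D) (ps : seq (D * seq D)).

Lemma adjC x y : adj x y = adj y x.
Proof. by rewrite /adj orbC. Qed.

Lemma sorted_arc_adj p : sorted (@arc D) p -> sorted (@adj D) p.
Proof. by apply: sub_sorted => x y; rewrite /adj => ->. Qed.

Lemma independent_alpha (S : {set D}) : independent S -> #|S| <= alpha D.
Proof. by move=> indS; apply: leq_bigmax_cond. Qed.

Lemma not_independentP (S : {set D}) :
  reflect (exists x y, [/\ x \in S, y \in S & arc x y]) (~~ independent S).
Proof.
rewrite /independent; apply: (iffP idP) => [|[x [y [xS yS xy]]]].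
  rewrite negb_forall => /existsP[x]; rewrite negb_imply => /andP[xS].
  rewrite negb_forall => /existsP[y]; rewrite negb_imply negbK => /andP[yS xy].
  by exists x, y.
apply/negP => /forall_inP/(_ x xS)/forall_inP/(_ y yS).
by rewrite xy.
Qed.

Lemma alpha2_adj x y z :
  alpha D <= 2 -> uniq [:: x; y; z] -> [|| adj x y, adj y z | adj x z].
Proof.
move=> a2 Uxyz.
have: ~~ independent [set v in [:: x; y; z]].
  apply/negP => /independent_alpha; rewrite cardsE (card_uniqP Uxyz).
  by move/leq_trans/(_ a2).
case/not_independentP=> u [v []]; rewrite !inE /adj.
move=> /or3P[]/eqP-> /or3P[]/eqP->; rewrite ?arc_irrefl // => ->;
  by rewrite ?orbT.
Qed.

(** If no edge left [A], then [A] would be closed under adjacency and contain every vertex reachable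
    from [x], among them [y]. *)
Lemma connected_crossing (A : pred D) x y :
  connected D -> A x -> ~~ A y -> exists u v, [/\ A u, ~~ A v & adj u v].
Proof.
move=> [_ conD] Ax Ay.
have [/existsP[u /existsP[v /and3P[]]]|noE] :=
  boolP [exists u, exists v, [&& A u, ~~ A v & adj u v]].
  by exists u, v.
have clA: closed (@adj D) A.
  apply: intro_closed => [|u v uv Au]; first exact/sym_connect_sym/adjC.
  apply: contraR noE => Av; apply/existsP; exists u; apply/existsP; exists v.
  by rewrite uv andbT; apply/andP.
have := closed_connect clA (conD x y).
by rewrite /in_mem /= Ax (negbTE Ay).
Qed.

(** * Dipath covers and the Gallai-Milgram theorem *)

(* A pair (x, s) stands for the dipath x :: s. *)
Definition cover_vertices ps := flatten [seq e.1 :: e.2 | e <- ps].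

(** Spanning all of [D] is not demanded, so that an induction may delete a vertex. *)
Definition dipath_cover ps :=
  uniq (cover_vertices ps) && all (fun e => path (@arc D) e.1 e.2) ps.

Lemma perm_cover_vertices ps1 ps2 : perm_eq ps1 ps2 ->
  perm_eq (cover_vertices ps1) (cover_vertices ps2).
Proof. by move=> pp; apply/perm_flatten/perm_map. Qed.

Lemma perm_dipath_cover ps1 ps2 :
  perm_eq ps1 ps2 -> dipath_cover ps1 = dipath_cover ps2.
Proof.
move=> pp; rewrite /dipath_cover (perm_uniq (perm_cover_vertices pp)).
by rewrite (perm_all _ pp).
Qed.

Lemma uniq_heads ps : dipath_cover ps -> uniq (unzip1 ps).
Proof.
case/andP=> Ups _; apply: subseq_uniq Ups.
elim: ps => //= e ps IH; rewrite eqxx.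
exact: subseq_trans IH (suffix_subseq _ _).
Qed.

Lemma extract_head ps x : x \in unzip1 ps ->
  exists s ps', perm_eq ps ((x, s) :: ps').
Proof.
by case/mapP=> -[y s] yps ->; exists s, (rem (y, s) ps); apply: perm_to_rem.
Qed.

(** Puts a deleted vertex back in front of the dipath with head [y]. The last clause records that
    [y] stops being a head and that only [x] can become one. *)
Lemma dipath_cover_cons ps x y :
  dipath_cover ps -> x \notin cover_vertices ps -> arc x y ->
  y \in unzip1 ps ->
  exists ps', [/\ dipath_cover ps', size ps' = size ps,
    perm_eq (cover_vertices ps') (x :: cover_vertices ps) &
    forall z, z \in unzip1 ps' ->
      z = x \/ [/\ z \in unzip1 ps & z != y]].
Proof.
move=> Cps xps xy /extract_head[s [qs pp]].
have Hv := perm_cover_vertices pp.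
have Cqs: dipath_cover ((y, s) :: qs) by rewrite -(perm_dipath_cover pp).
exists ((x, y :: s) :: qs); split.
- move: Cqs; rewrite /dipath_cover /= xy => /andP[Uqs ->].
  by rewrite andbT; apply/andP; split => //; rewrite -(perm_mem Hv).
- by rewrite (perm_size pp).
- by rewrite perm_sym /= perm_cons.
- move=> z; rewrite inE => /predU1P[->|zqs]; [by left | right].
  split; first by rewrite (perm_mem (perm_map _ pp)) inE zqs orbT.
  by apply: contraTneq zqs => ->; case/andP: (uniq_heads Cqs).
Qed.

(* The constraint on the heads is what makes the induction go through. *)
Lemma dipath_cover_shrink ps : dipath_cover ps -> alpha D < size ps ->
  exists ps', [/\ dipath_cover ps', (size ps').+1 = size ps,
    perm_eq (cover_vertices ps') (cover_vertices ps) &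
    {subset unzip1 ps' <= unzip1 ps}].
Proof.
have [n] := ubnP (size (cover_vertices ps)).
elim: n ps => // n IH ps lt_n Cps lt_a.
(* There are more heads than [alpha D], so some arc [xy] joins two of them. *)
have: ~~ independent [set x in unzip1 ps].
  apply/negP => /independent_alpha.
  rewrite cardsE (card_uniqP (uniq_heads Cps)) size_map.
  by rewrite leqNgt lt_a.
case/not_independentP=> x [y []]; rewrite !inE => xps yps xy.
have [s [qs pp]] := extract_head xps.
have Hv := perm_cover_vertices pp.
have Hh := perm_map fst pp; rewrite /= in Hh.
have Cqs: dipath_cover ((x, s) :: qs) by rewrite -(perm_dipath_cover pp).
have yqs: y \in unzip1 qs.
  move: yps; rewrite (perm_mem Hh) inE => /predU1P[yx|//].
  by rewrite yx arc_irrefl in xy.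
(* If [x] is a dipath by itself, prefixing it to the dipath of [y] saves one dipath. Otherwise
   delete [x], making its successor [x'] a head, apply induction, and put [x] back before [x'] or
   [y]. *)
case: s => [|x' s] in pp Hv Cqs *.
  have Cqs': dipath_cover qs.
    by move: Cqs; rewrite /dipath_cover /= => /andP[/andP[_ ->]].
  have xqs: x \notin cover_vertices qs.
    by move: Cqs; rewrite /dipath_cover /= => /andP[/andP[]].
  have [ps' [C' s' p' h']] := dipath_cover_cons Cqs' xqs xy yqs.
  exists ps'; split => //; first by rewrite s' (perm_size pp).
    by rewrite (perm_trans p') // perm_sym.
  move=> z /h' zh; rewrite (perm_mem Hh) inE.
  by case: zh => [->|[-> _]]; rewrite ?eqxx ?orbT.
set rs := (x', s) :: qs.
have [Crs xrs xx']: [/\ dipath_cover rs, x \notin cover_vertices rs & arc x x'].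
  move: Cqs; rewrite /dipath_cover /= => /and3P[/andP[-> ->] /andP[-> ->] ->].
  by [].
have [|//||ps1 [C1 s1 p1 h1]] := IH rs.
- by rewrite -ltnS; move: lt_n; rewrite (perm_size Hv) /=.
- by move: lt_a; rewrite (perm_size pp).
have xps1: x \notin cover_vertices ps1 by rewrite (perm_mem p1).
have pfin ps' : perm_eq (cover_vertices ps') (x :: cover_vertices ps1) ->
    perm_eq (cover_vertices ps') (cover_vertices ps).
  move=> p'; rewrite (perm_trans p') // perm_sym (perm_trans Hv) //=.
  by rewrite perm_cons perm_sym.
have [x'1|x'1] := boolP (x' \in unzip1 ps1).
  have [ps' [C' s' p' h']] := dipath_cover_cons C1 xps1 xx' x'1.
  exists ps'; split => //; [by rewrite s' s1 (perm_size pp)|exact: pfin|].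
  move=> z /h'[->|[/h1 + zx']] //.
  by rewrite (perm_mem Hh) !inE /= (negbTE zx') /= => ->; rewrite orbT.
have h1' : {subset unzip1 ps1 <= unzip1 qs}.
  move=> z zps1; have := h1 z zps1; rewrite inE /= => /predU1P[zx'|//].
  by rewrite -zx' zps1 in x'1.
(* Without [x'], the heads of [ps1] lie among those of [qs]; both lists have the same size, so they
   have the same members and [y] is still a head. *)
have y1: y \in unzip1 ps1.
  have/uniq_min_size : uniq (unzip1 ps1) by exact: uniq_heads.
  case/(_ _ h1') => [|_ ->//].
  by rewrite !size_map; case: s1 => ->.
have [ps' [C' s' p' h']] := dipath_cover_cons C1 xps1 xy y1.
exists ps'; split => //; [by rewrite s' s1 (perm_size pp)|exact: pfin|].
move=> z /h'[->|[/h1' + _]] //.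
by rewrite (perm_mem Hh) inE => ->; rewrite orbT.
Qed.

(** Start with one trivial dipath per vertex and shrink the cover as long as it has more than
    [alpha D] dipaths. *)
Lemma Gallai_Milgram :
  exists ps, [/\ dipath_cover ps, size ps <= alpha D &
                 forall x, x \in cover_vertices ps].
Proof.
pose ps0 := [seq (x, [::] : seq D) | x <- enum D].
have v0: cover_vertices ps0 = enum D.
  by rewrite /cover_vertices -map_comp; apply: flatten_seq1.
have C0: dipath_cover ps0.
  by rewrite /dipath_cover v0 enum_uniq all_map; apply/allP.
have : forall x, x \in cover_vertices ps0 by move=> x; rewrite v0 mem_enum.
have [n] := ubnP (size ps0).
elim: n ps0 C0 {v0} => // n IH ps Cps lt_n Hps.
have [le_a|lt_a] := leqP (size ps) (alpha D); first by exists ps.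
have [ps' [C' s' p' _]] := dipath_cover_shrink Cps lt_a.
by apply: (IH ps') => // [|x]; rewrite ?s' // (perm_mem p').
Qed.

(** * Backward arcs under concatenation and rotation *)

Lemma backward_arcs_cat x s y t :
  backward_arcs (x :: s ++ y :: t) =
  backward_arcs (x :: s) + ~~ arc (last x s) y + backward_arcs (y :: t).
Proof.
elim: s x => //= z s IH x.
by rewrite {1}/backward_arcs /= -/(backward_arcs _) IH !addnA.
Qed.

Lemma backward_arcs_cat_le p q :
  backward_arcs (p ++ q) <= (backward_arcs p + backward_arcs q).+1.
Proof.
case: p q => [|x s] [|y t] //; first by rewrite cats0 addn0.
rewrite cat_cons backward_arcs_cat -addnS addnAC -addnA leq_add2l addnC.
by case: arc.
Qed.

Lemma backward_arcs_dipath p : sorted (@arc D) p -> backward_arcs p = 0.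
Proof.
case: p => // x s; elim: s x => //= y s IH x /andP[xy ys].
by rewrite /backward_arcs /= xy; apply: IH.
Qed.

Lemma sorted_cat_cons (e : rel D) x s y t :
  sorted e (x :: s ++ y :: t) =
  [&& sorted e (x :: s), e (last x s) y & sorted e (y :: t)].
Proof. by rewrite /= cat_path. Qed.

(* Dipaths whose rotations are orpaths; singletons must be listed because adj
   is irreflexive. *)
Definition closable x s := (s == [::]) || adj (last x s) x.

(** The only new consecutive pair goes from the end of the dipath to its start; closability makes it
    adjacent, and it alone can be backward. *)
Lemma rotate_dipath x s p q :
  path (@arc D) x s -> closable x s -> x :: s = p ++ q ->
  sorted (@adj D) (q ++ p) /\ backward_arcs (q ++ p) <= 1.
Proof.
move=> xs cl eqs.
have: sorted (@arc D) (p ++ q) by rewrite -eqs.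
case: p q eqs => [|x' p] [|y q] // Es.
1,2: by rewrite cats0 => ar; split;
  [apply: sorted_arc_adj | rewrite backward_arcs_dipath].
case: Es => xx' Es; rewrite -{}xx' cat_cons sorted_cat_cons => /and3P[xp _ yq].
have {}cl : adj (last y q) x.
  by move: cl; rewrite /closable -size_eq0 Es size_cat addnS last_cat.
split; last first.
  by rewrite (leq_trans (backward_arcs_cat_le _ _)) // !backward_arcs_dipath.
by rewrite cat_cons sorted_cat_cons cl !sorted_arc_adj.
Qed.

Lemma exists_switch (a : pred D) x s :
  a x -> ~~ a (last x s) ->
  exists s1 y s2, [/\ s = s1 ++ y :: s2, a (last x s1) & ~~ a y].
Proof.
elim: s x => [|y s IH] x ax /=; first by rewrite ax.
have [ay|nay] := boolP (a y); last by exists [::], y, s.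
by case/IH => // s1 [z [s2 [-> h nz]]]; exists (y :: s1), z, s2.
Qed.

Lemma link_arc p u v q :
  sorted (@adj D) (rcons p u) -> sorted (@adj D) (v :: q) -> arc u v ->
  sorted (@adj D) (rcons p u ++ v :: q) /\
  backward_arcs (rcons p u ++ v :: q) =
    backward_arcs (rcons p u) + backward_arcs (v :: q).
Proof.
case Ep: (rcons p u) => [|x s]; first by case: p Ep.
have lu : last x s = u by rewrite -(last_rcons x p u) Ep.
move=> xs vq uv; rewrite cat_cons backward_arcs_cat sorted_cat_cons lu uv xs vq.
by rewrite /adj uv addn0.
Qed.

(** * Joining two dipaths *)

Lemma join_closable x s y t u v :
  path (@arc D) x s -> path (@arc D) y t -> closable x s -> closable y t ->
  u \in x :: s -> v \in y :: t -> arc u v ->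
  exists p, [/\ perm_eq p ((x :: s) ++ (y :: t)), sorted (@adj D) p &
                backward_arcs p <= 2].
Proof.
move=> xs yt clx cly us vt uv.
have [s1 [s2 Es]] : exists s1 s2, x :: s = rcons s1 u ++ s2.
  by case/splitPr: us => s1 s2; exists s1, s2; rewrite cat_rcons.
have [t1 [t2 Et]] : exists t1 t2, y :: t = t1 ++ v :: t2.
  by case/splitPr: vt => t1 t2; exists t1, t2.
have [] := rotate_dipath xs clx Es; rewrite -rcons_cat => sS bS.
have [sT bT] := rotate_dipath yt cly Et.
have [sST bST] := link_arc sS sT uv.
(* The first dipath is rotated to end at [u], the second to start at [v]; the arc [uv] is forward
   and costs nothing. *)
exists (rcons (s2 ++ s1) u ++ (v :: t2) ++ t1); split=> //.
  by rewrite Es Et rcons_cat perm_cat // perm_catC.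
by rewrite bST (leq_add bS bT).
Qed.

Lemma join_end_start x s y t :
  path (@arc D) x s -> path (@arc D) y t -> adj (last x s) y ->
  sorted (@adj D) ((x :: s) ++ (y :: t)) /\
  backward_arcs ((x :: s) ++ (y :: t)) <= 2.
Proof.
move=> xs yt sy; rewrite cat_cons sorted_cat_cons sy !sorted_arc_adj //.
rewrite backward_arcs_cat !(backward_arcs_dipath (p := _ :: _)) //.
by case: arc.
Qed.

Lemma insert_dipath x s y t :
  alpha D <= 2 -> uniq ((x :: s) ++ (y :: t)) ->
  path (@arc D) x s -> path (@arc D) y t ->
  ~~ closable x s -> ~~ adj (last x s) y -> ~~ adj (last y t) x ->
  exists p, [/\ perm_eq p ((x :: s) ++ (y :: t)), sorted (@adj D) p &
                backward_arcs p <= 2].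
Proof.
move=> a2 U xs yt; rewrite /closable negb_or => /andP[s0 nsx] nsy ntx.
(* The ends of [x :: s] are distinct and nonadjacent, so a third vertex adjacent to neither would
   give an independent triple. *)
have xz z : z \in y :: t -> adj x z || adj z (last x s).
  move=> zt; have: uniq [:: x; z; last x s].
    move: U; rewrite cat_uniq => /and3P[/andP[xs' _] /hasPn h _].
    have {h}zs := h z zt.
    case: (lastP s) s0 xs' zs {xs nsx nsy} => // s' w _.
    rewrite last_rcons !inE !mem_rcons !inE !negb_or => /andP[xw _] /and3P[zx zw _].
    by rewrite /= !inE negb_or xw zw eq_sym zx.
  by move/(alpha2_adj a2); rewrite [adj x (last _ _)]adjC (negbTE nsx) orbF.
have xy : adj x y.
  by have := xz y (mem_head _ _); rewrite [adj y _]adjC (negbTE nsy) orbF.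
have [|t1 [z [t2 [Et xt1 nxz]]]] := exists_switch xy (s := t); first by rewrite adjC.
have sz : adj (last x s) z.
  have := xz z; rewrite (negbTE nxz) adjC; apply.
  by rewrite Et inE mem_cat mem_head !orbT.
(* Only the two junctions around [x :: s] can be backward. *)
exists ((y :: t1) ++ (x :: s) ++ (z :: t2)).
move: yt; rewrite Et -/(sorted _ (y :: t1 ++ z :: t2)) sorted_cat_cons.
case/and3P=> yt1 _ zt2; split.
- by rewrite -[y :: t1 ++ _]cat_cons perm_catCA.
- by rewrite !(cat_cons, sorted_cat_cons) adjC xt1 sz !sorted_arc_adj.
rewrite !cat_cons backward_arcs_cat backward_arcs_cat.
by rewrite !(backward_arcs_dipath (p := _ :: _)) //; do 2!case: arc.
Qed.

Lemma join_two_dipaths x s y t :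
  connected D -> alpha D <= 2 -> uniq ((x :: s) ++ (y :: t)) ->
  (forall z, z \in (x :: s) ++ (y :: t)) ->
  path (@arc D) x s -> path (@arc D) y t ->
  exists p, [/\ perm_eq p ((x :: s) ++ (y :: t)), sorted (@adj D) p &
                backward_arcs p <= 2].
Proof.
move=> conD a2 U full xs yt; set st := _ ++ _.
have Cst : perm_eq ((y :: t) ++ (x :: s)) st by rewrite perm_catC.
have [sy|nsy] := boolP (adj (last x s) y).
  by have [] := join_end_start xs yt sy; exists st.
have [tx|ntx] := boolP (adj (last y t) x).
  by have [] := join_end_start yt xs tx; exists ((y :: t) ++ (x :: s)).
have [clx|] := boolP (closable x s); last by move=> ncl; apply: insert_dipath.
have [cly|ncly] := boolP (closable y t); last first.
  have [|p [pp]] := insert_dipath a2 _ yt xs ncly ntx nsy.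
    by rewrite (perm_uniq Cst).
  by exists p; rewrite (perm_trans pp).
have nyx : y \notin x :: s.
  by move: U; rewrite cat_uniq => /and3P[_ /hasPn-> //]; rewrite mem_head.
have [u [v [us vs uv]]] :=
  connected_crossing (A := mem (x :: s)) conD (mem_head x s) nyx.
have vt : v \in y :: t by move: (full v); rewrite mem_cat => /orP[/(negP vs)|].
(* If the crossing arc runs from [v] to [u], the two dipaths exchange roles. *)
case/orP: uv => uv; first exact: join_closable uv.
have [p [pp]] := join_closable yt xs cly clx vt us uv.
by exists p; rewrite (perm_trans pp).
Qed.

Lemma connected_alpha2_orpath : connected D -> alpha D <= 2 ->
  exists p : seq D, Hamilton_orpath p /\ backward_arcs p <= 2.
Proof.
move=> conD a2; have [ps [/andP[U P] sz full]] := Gallai_Milgram.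
suff [p [pp sp bp]]: exists p, [/\ perm_eq p (cover_vertices ps),
    sorted (@adj D) p & backward_arcs p <= 2].
  exists p; rewrite /Hamilton_orpath /orpath (perm_uniq pp) U sp; split=> //.
  by apply/forallP => x; rewrite (perm_mem pp).
case: ps {sz} (leq_trans sz a2) U P full => [|[x s] [|[y t] [|//]]] _;
  rewrite /cover_vertices /= ?cats0.
- by exists [::].
- move=> _ /andP[xs _] _; exists (x :: s).
  by rewrite (sorted_arc_adj (p := _ :: _)) // backward_arcs_dipath.
- by move=> U /and3P[xs yt _] full; apply: join_two_dipaths.
Qed.

End PathCovers.

(** * Sharpness of the bound two *)

(* Two transitive triangles joined by an arc between their middle vertices. *)
Definition triangles_arc (i j : nat) : bool :=
  (i < j) && ((i < 3) == (j < 3)) || (i == 1) && (j == 4).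

Lemma triangles_arc_irrefl :
  irreflexive (fun i j : 'I_6 => triangles_arc i j).
Proof. by case=> -[|[|i]] lt6; rewrite /triangles_arc ltnn. Qed.

Definition triangles : digraph := Digraph triangles_arc_irrefl.

Lemma connected_triangles : connected triangles.
Proof.
split; first by rewrite card_ord.
have symD: connect_sym (@adj triangles) by apply/sym_connect_sym/adjC.
pose a : triangles := inord 1; pose b : triangles := inord 4.
have ab : connect (@adj triangles) a b.
  by apply: connect1; rewrite /adj /= /triangles_arc !inordK.
suff H x : connect (@adj triangles) a x.
  by move=> x y; apply: connect_trans (H y); rewrite symD.
(* Each vertex equals or neighbours the middle vertex of its triangle. *)
have [|h] : connect (@adj triangles) a x \/ connect (@adj triangles) b x; last 1 first.
- exact: connect_trans h.
- case: x => -[|[|[|[|[|[|//]]]]]] lt6; [left|left|left|right|right|right];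
    try (by apply: connect1; rewrite /adj /= /triangles_arc !inordK);
    by apply: eq_connect0; apply: val_inj; rewrite /= inordK.
- by [].
Qed.

Lemma alpha_triangles : alpha triangles <= 2.
Proof.
apply/bigmax_leqP => S /forall_inP indS.
(* An independent set has at most one vertex per triangle, so naming the triangle injects it into
   [bool]. *)
rewrite -(@card_in_imset _ _ (fun i : 'I_6 => i < 3) S); last first.
  move=> i j iS jS /= ij; apply: val_inj.
  have := indS i iS => /forall_inP/(_ j jS).
  have := indS j jS => /forall_inP/(_ i iS).
  rewrite /= /triangles_arc ij eqxx !andbT !negb_or -!leqNgt.
  by move=> /andP[ji _] /andP[ij' _]; apply/eqP; rewrite eqn_leq ji ij'.
by apply: leq_trans (max_card _) _; rewrite card_bool.
Qed.

Lemma count_zip_map (S T : Type) (f : S -> T) (a : pred (T * T)) s t :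
  count a (zip (map f s) (map f t)) =
  count (fun e => a (f e.1, f e.2)) (zip s t).
Proof. by elim: s t => [|x s IH] [|y t] //=; rewrite IH. Qed.

(** A Hamilton orpath crosses between the triangles only once, along the edge between the middle
    vertices. It thus exhausts one triangle ending at its middle vertex and traverses the other
    starting at its middle vertex, and each of these traversals has a backward arc. The proof checks
    all orderings of the six vertices by computation. *)
Lemma triangles_orpath (p : seq triangles) :
  Hamilton_orpath p -> 2 <= backward_arcs p.
Proof.
move=> /andP[/andP[Up sp] /forallP full].
have pp : perm_eq (map val p) (iota 0 6).
  rewrite -(val_enum_ord 6); apply/perm_map/uniq_perm; rewrite ?enum_uniq //.
  by move=> i; rewrite full mem_enum.
have: all (fun q => sorted (fun i j => triangles_arc i j || triangles_arc j i) q ==>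
    (2 <= count (fun e => ~~ triangles_arc e.1 e.2) (zip q (behead q))))
  (permutations (iota 0 6)) by vm_compute.
move/allP/(_ (map val p)); rewrite mem_permutations pp => /(_ isT).
by rewrite sorted_map sp behead_map count_zip_map.
Qed.

Theorem theorem1p2 :
  (forall D : digraph, connected D -> alpha D <= 2 ->
     exists p : seq D, Hamilton_orpath p /\ backward_arcs p <= 2)
  /\
  (exists D : digraph, connected D /\ alpha D <= 2 /\
     ~ (exists p : seq D, Hamilton_orpath p /\ backward_arcs p < 2)).
Proof.
split; first exact: connected_alpha2_orpath.
exists triangles; split; first exact: connected_triangles.
split; first exact: alpha_triangles.
by case=> p [/triangles_orpath]; rewrite leqNgt => /negP.
Qed.
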